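(* Let $\delta\in\mathbb R$. Any $3$-$\delta$-cosymplectic manifold $(M,\varphi_i,\xi_i,\eta_i,g)$, $i=1,2,3$, is a parallel canonical almost $3$-contact metric manifold.
   Context: An almost contact metric structure $(\varphi,\xi,\eta,g)$ consists of a $(1,1)$-tensor field $\varphi$, a vector field $\xi$, a $1$-form $\eta$ and a Riemannian metric $g$ with $\varphi^2=-I+\eta\otimes\xi$, $\eta(\xi)=1$, $g(\varphi X,\varphi Y)=g(X,Y)-\eta(X)\eta(Y)$. Its fundamental form is $\Phi(X,Y)=g(X,\varphi Y)$, and $N_\varphi(X,Y)=[\varphi X,\varphi Y]+\varphi^2[X,Y]-\varphi[\varphi X,Y]-\varphi[X,\varphi Y]+d\eta(X,Y)\xi$, $N_\varphi(X,Y,Z)=g(N_\varphi(X,Y),Z)$. An almost $3$-contact metric manifold $(M,\varphi_i,\xi_i,\eta_i,g)$, $i=1,2,3$, is a manifold of dimension $4n+3$ with three almost contact metric structures with the same $g$ such that, for every even permutation $(i,j,k)$ of $(1,2,3)$, $\varphi_k=\varphi_i\varphi_j-\eta_j\otimes\xi_i=-\varphi_j\varphi_i+\eta_i\otimes\xi_j$, $\xi_k=\varphi_i\xi_j=-\varphi_j\xi_i$, $\eta_k=\eta_i\circ\varphi_j=-\eta_j\circ\varphi_i$. Set $\mathcal H=\bigcap_i\ker\eta_i$. It is $3$-$\delta$-cosymplectic, $\delta\in\mathbb R$, if $d\eta_i=-2\delta\,\eta_j\wedge\eta_k$ and $d\Phi_i=0$ for every even permutation $(i,j,k)$ of $(1,2,3)$.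 For $X,Y\in\Gamma(\mathcal H)$ let $A_{ij}(X,Y)=g((\mathcal L_{\xi_j}\varphi_i)X,Y)+d\eta_j(X,\varphi_iY)+d\eta_j(\varphi_iX,Y)$, $A_i=A_{ii}$. $M$ admits a Reeb Killing function $\beta\in C^\infty(M)$ if $A_i(X,Y)=0$ and $A_{ij}(X,Y)=-A_{ji}(X,Y)=\beta\Phi_k(X,Y)$ for all $X,Y\in\Gamma(\mathcal H)$ and every even permutation $(i,j,k)$ of $(1,2,3)$. $M$ is canonical if: 1) each $N_{\varphi_i}$ is skew-symmetric on $\mathcal H$ (i.e. $N_{\varphi_i}(X,Y,Z)$ restricted to $\mathcal H$ is a $3$-form); 2) each $\xi_i$ is Killing; 3) $N_{\varphi_i}(X,Y,Z)-d\Phi_i(\varphi_iX,\varphi_iY,\varphi_iZ)=N_{\varphi_j}(X,Y,Z)-d\Phi_j(\varphi_jX,\varphi_jY,\varphi_jZ)$ for all $X,Y,Z\in\Gamma(\mathcal H)$ and all $i,j$; 4) $M$ admits a Reeb Killing function $\beta$. It is a parallel canonical manifold if moreover $\beta=0$, i.e. $A_{ij}=0$ for all $i,j=1,2,3$. Conventions: $d\eta(X,Y)=X(\eta(Y))-Y(\eta(X))-\eta([X,Y])$, $(\eta\wedge\zeta)(X,Y)=\eta(X)\zeta(Y)-\eta(Y)\zeta(X)$, and analogously (no numerical factors) in higher degree. *)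

(* Defs.v *)
From HB Require Import structures.
From mathcomp Require Import all_boot all_order all_algebra all_fingroup.
From mathcomp Require Import all_classical all_reals all_analysis.

Set Implicit Arguments.
Unset Strict Implicit.
Unset Printing Implicit Defensive.

Import Order.TTheory GRing.Theory Num.Theory.
Import numFieldNormedType.Exports.

Local Open Scope classical_set_scope.
Local Open Scope ring_scope.

Lemma open_near_eq (T : topologicalType) (W : Type) (U : set T) (f h : T -> W)
    (x : T) :
  open U -> U x -> (forall y, U y -> f y = h y) -> {near x, f =1 h}.
Proof.
move=> oU Ux fh; have nU : nbhs x U by exact: open_nbhs_nbhs.
by apply: filterS nU => y /fh.
Qed.

Lemma open_eq_continuous (T W : topologicalType) (U : set T) (f h : T -> W)
    (x : T) :
  open U -> U x -> (forall y, U y -> f y = h y) ->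
  {for x, continuous f} -> {for x, continuous h}.
Proof.
move=> oU Ux fh; rewrite /prop_for /continuous_at -(fh _ Ux) => cf.
by apply: cvg_trans cf; apply: near_eq_cvg; exact: open_near_eq oU Ux fh.
Qed.

Section SmoothOnEuclidean.
Variables (R : realType) (m : nat).
Implicit Types (U : set 'rV[R]_m) (f h : 'rV[R]_m -> R).

(* f is C^k on U (meant for U open): all iterated partial derivatives of order
   at most k exist and are continuous on U. *)
Fixpoint Ck_on (k : nat) U f : Prop :=
  (forall x, U x -> {for x, continuous f}) /\
  match k with
  | 0 => True
  | k'.+1 => forall i : 'I_m,
      (forall x, U x -> derivable f x (delta_mx 0 i)) /\
      Ck_on k' U ('D_(delta_mx 0 i) f)
  end.

Definition smooth_on U f := forall k, Ck_on k U f.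

Lemma Ck_on_continuous k U f :
  Ck_on k U f -> forall x, U x -> {for x, continuous f}.
Proof. by case: k => [|k] []. Qed.

Lemma Ck_onW k U f : Ck_on k.+1 U f -> Ck_on k U f.
Proof.
elim: k f => [|k IH] f [cf df]; first by split.
by split=> // i; have [dfi /IH] := df i.
Qed.

Lemma Ck_on_eq k U f h :
  open U -> (forall x, U x -> f x = h x) -> Ck_on k U f -> Ck_on k U h.
Proof.
move=> oU; elim: k f h => [|k IH] f h fh.
  case=> cf _; split=> // x Ux.
  exact: (open_eq_continuous oU Ux fh (cf _ Ux)).
move=> Hf; have [_ df] := Hf.
have nfh x : U x -> {near x, f =1 h}.
  by move=> Ux; exact: open_near_eq oU Ux fh.
split.
  exact: Ck_on_continuous (IH _ _ fh (Ck_onW Hf)).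
move=> i; have [dfi Dfi] := df i.
split=> [x Ux|]; first exact: near_eq_derivable (nfh x Ux) (dfi x Ux).
by apply: IH Dfi => x Ux; apply: near_eq_derive; exact: nfh.
Qed.

Lemma Ck_on_cst k U (a : R) : Ck_on k U (cst a).
Proof.
elim: k a => [|k IH] a; split=> //;
  try by move=> x _; exact: cst_continuous.
move=> i.
split=> [x _|]; first exact: derivable_cst.
suff -> : 'D_(delta_mx 0 i) (cst a : 'rV[R]_m -> R) = cst 0 by exact: IH.
by apply/funext => x; rewrite derive_cst.
Qed.

Lemma Ck_onD k U f h :
  open U -> Ck_on k U f -> Ck_on k U h -> Ck_on k U (f + h).
Proof.
move=> oU; elim: k f h => [|k IH] f h [cf df] [ch dh]; split=> //;
  try by move=> x Ux; apply: continuousD; [exact: cf|exact: ch].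
move=> i; have [dfi Dfi] := df i; have [dhi Dhi] := dh i.
split=> [x Ux|]; first by apply: derivableD; [exact: dfi|exact: dhi].
apply: Ck_on_eq oU _ (IH _ _ Dfi Dhi) => x Ux.
by rewrite deriveD; [|exact: dfi|exact: dhi].
Qed.

Lemma Ck_onM k U f h :
  open U -> Ck_on k U f -> Ck_on k U h -> Ck_on k U (f * h).
Proof.
move=> oU; elim: k f h => [|k IH] f h Cf Ch; have [cf df] := Cf;
  have [ch dh] := Ch; split=> //;
  try by move=> x Ux; apply: continuousM; [exact: cf|exact: ch].
move=> i; have [dfi Dfi] := df i; have [dhi Dhi] := dh i.
split=> [x Ux|]; first by apply: derivableM; [exact: dfi|exact: dhi].
apply: Ck_on_eq oU _ (Ck_onD oU (IH _ _ (Ck_onW Cf) Dhi)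
                                (IH _ _ (Ck_onW Ch) Dfi)) => x Ux.
by rewrite deriveM; [|exact: dfi|exact: dhi].
Qed.

End SmoothOnEuclidean.

(* A chart with domain [chart_dom], open in M, and image [chart_cod], open in
   R^m; [coord] and [param] are mutually inverse homeomorphisms between the
   two, with irrelevant values elsewhere. *)
Record chart (R : realType) (m : nat) (M : topologicalType) := Chart {
  chart_dom : set M;
  chart_cod : set 'rV[R]_m;
  coord : M -> 'rV[R]_m;
  param : 'rV[R]_m -> M;
  chart_dom_open : open chart_dom;
  chart_cod_open : open chart_cod;
  coord_cod : forall p, chart_dom p -> chart_cod (coord p);
  param_dom : forall x, chart_cod x -> chart_dom (param x);
  coordK : {in chart_dom, cancel coord param};
  paramK : {in chart_cod, cancel param coord};
  coord_continuous : {within chart_dom, continuous coord};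
  param_continuous : {within chart_cod, continuous param}
}.

Definition compatible (R : realType) (m : nat) (M : topologicalType)
    (c c' : chart R m M) :=
  forall i : 'I_m,
    smooth_on (chart_cod c `&` param c @^-1` chart_dom c')
      (fun x => coord c' (param c x) 0 i).

(* Hausdorff, second countable, without boundary; neither connectedness nor
   maximality of the atlas is required. *)
Record manifold (R : realType) (m : nat) := Manifold {
  points :> topologicalType;
  points_hausdorff : hausdorff_space points;
  points_second_countable : @second_countable points;
  atlas : set (chart R m points);
  atlas_cover : forall p, exists2 c, atlas c & chart_dom c p;
  atlas_compatible : forall c c', atlas c -> atlas c' -> compatible c c'
}.

Section SmoothFunctions.
Variables (R : realType) (m : nat) (M : manifold R m).

Definition smooth (f : M -> R) : Prop :=
  forall c, atlas c -> smooth_on (chart_cod c) (f \o param c).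

Definition smooth_pred : {pred M -> R} := fun f => `[< smooth f >].

Fact smooth_subring : subring_closed smooth_pred.
Proof.
split=> [|f h|f h].
- by apply/asboolP => c _ k; exact: Ck_on_cst.
- move=> /asboolP sf /asboolP sh; apply/asboolP => c ac k.
  have -> : (f - h) \o param c = (f \o param c) + cst (-1) * (h \o param c).
    by apply/funext => x; rewrite /= !fctE /= mulN1r.
  have oc := @chart_cod_open _ _ _ c.
  apply: (Ck_onD oc (sf c ac k)); apply: (Ck_onM oc _ (sh c ac k)).
  exact: Ck_on_cst.
- move=> /asboolP sf /asboolP sh; apply/asboolP => c ac k.
  exact: (Ck_onM (@chart_cod_open _ _ _ c) (sf c ac k) (sh c ac k)).
Qed.

HB.instance Definition _ :=
  GRing.isSubringClosed.Build (M -> R) smooth_pred smooth_subring.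

Fact smooth_scaler (a : R) (f : M -> R) :
  f \in smooth_pred -> a *: f \in smooth_pred.
Proof.
move=> /asboolP sf; apply/asboolP => c ac k.
exact: (Ck_onM (@chart_cod_open _ _ _ c) (Ck_on_cst k _ a) (sf c ac k)).
Qed.

HB.instance Definition _ :=
  GRing.isScaleClosed.Build R (M -> R) smooth_pred smooth_scaler.

(* The ring C^oo(M). *)
Record Cinfty := MkCinfty {
  Cinfty_fun :> M -> R;
  Cinfty_smooth : Cinfty_fun \in smooth_pred
}.

HB.instance Definition _ := [isSub for Cinfty_fun].
HB.instance Definition _ := [Choice of Cinfty by <:].
HB.instance Definition _ := 
  GRing.SubChoice_isSubComPzRing.Build _ _ Cinfty (subringClosedP _).
HB.instance Definition _ := [SubZmodule_isSubLmodule of Cinfty by <:].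

End SmoothFunctions.

Section VectorFields.
Variables (R : realType) (m : nat) (M : manifold R m).
Local Notation C := (Cinfty M).

Definition derivation (D : C -> C) : Prop :=
  (forall (a : R) (f h : C), D (a *: f + h) = a *: D f + D h) /\
  (forall f h : C, D (f * h) = f * D h + h * D f).

Definition derivation_pred : {pred C -> C^o} := fun D => `[< derivation D >].

Fact scaleCA (a : R) (f h : C) : f * (a *: h) = a *: (f * h).
Proof. by apply/val_inj/funext => p; rewrite /= !fctE /= scalerAr. Qed.

Fact derivation_submod : submod_closed derivation_pred.
Proof.
split=> [|u D E /asboolP[D1 D2] /asboolP[E1 E2]]; apply/asboolP; split.
- by move=> a f h; rewrite scaler0 addr0.
- by move=> f h; rewrite !mulr0 addr0.
- move=> a f h; change (u * D (a *: f + h) + E (a *: f + h) =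
    a *: (u * D f + E f) + (u * D h + E h)).
  by rewrite D1 E1 mulrDr scaleCA scalerDr addrACA.
- move=> f h; change (u * D (f * h) + E (f * h) =
    f * (u * D h + E h) + h * (u * D f + E f)).
  by rewrite D2 E2 !mulrDr addrACA (mulrCA u f) (mulrCA u h).
Qed.

HB.instance Definition _ :=
  GRing.isSubmodClosed.Build C (C -> C^o) derivation_pred derivation_submod.

(* Smooth vector fields, as derivations of C^oo(M); they form a module over
   C^oo(M) for (f *: X) h = f * X h. *)
Record vfield := MkVfield {
  vfield_fun :> C -> C^o;
  vfield_derivation : vfield_fun \in derivation_pred
}.

HB.instance Definition _ := [isSub for vfield_fun].
HB.instance Definition _ := [Choice of vfield by <:].
HB.instance Definition _ := [SubChoice_isSubLmodule of vfield by <:].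

(* [X f] seen in the ring C rather than in the module C^o. *)
Definition vapply (X : vfield) (f : C) : C := X f.

(* The tangent vector X_p, as a point derivation. *)
Definition tangent_at (X : vfield) (p : M) : C -> R := fun f => vapply X f p.

Fact bracket_derivation (X Y : vfield) :
  (fun f => vapply X (vapply Y f) - vapply Y (vapply X f) : C^o)
    \in derivation_pred.
Proof.
case: X Y => [X hX] [Y hY]; rewrite /vapply /=.
move/asboolP: hX => [X1 X2]; move/asboolP: hY => [Y1 Y2].
have XD f h : X (f + h) = X f + X h by have := X1 1 f h; rewrite !scale1r.
have YD f h : Y (f + h) = Y f + Y h by have := Y1 1 f h; rewrite !scale1r.
apply/asboolP; split=> [a|] f h.
  rewrite X1 Y1 [X in X - _]X1 [X in _ - X]Y1.
  by rewrite opprD scalerBr addrACA.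
rewrite X2 Y2 [X in X - _]XD [X in _ - X]YD.
rewrite [X (f * Y h)]X2 [X (h * Y f)]X2 [Y (f * X h)]Y2 [Y (h * X f)]Y2.
change ((f * X (Y h) + Y h * X f + (h * X (Y f) + Y f * X h)) -
        (f * Y (X h) + X h * Y f + (h * Y (X f) + X f * Y h)) =
        f * (X (Y h) - Y (X h)) + h * (X (Y f) - Y (X f)) :> C).
rewrite (mulrC (X h : C)) (mulrC (X f : C)) !mulrBr.
set a := (f : C) * _; set b := (Y h : C) * _; set c := (h : C) * _.
set d := (Y f : C) * _; set e := (f : C) * _; set k := (h : C) * _.
rewrite [a + b + _]addrACA [e + d + _]addrACA [d + b]addrC.
by rewrite [e + k + _]addrC addrKA opprD addrACA.
Qed.

Definition bracket (X Y : vfield) : vfield := MkVfield (bracket_derivation X Y).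

End VectorFields.

Section TensorCalculus.
Variables (R : realType) (m : nat) (M : manifold R m).
Local Notation C := (Cinfty M).
Local Notation V := (vfield M).
Implicit Types (X Y Z : V).

(* Exterior derivative and wedge product without numerical factors. *)
Definition ext_d1 (eta : V -> C) X Y : C :=
  vapply X (eta Y) - vapply Y (eta X) - eta (bracket X Y).

Definition ext_d2 (om : V -> V -> C) X Y Z : C :=
  vapply X (om Y Z) - vapply Y (om X Z) + vapply Z (om X Y)
  - om (bracket X Y) Z + om (bracket X Z) Y - om (bracket Y Z) X.

Definition wedge (eta zeta : V -> C) X Y : C :=
  eta X * zeta Y - eta Y * zeta X.

Definition lie_endo (xi : V) (phi : V -> V) X : V :=
  bracket xi (phi X) - phi (bracket xi X).

Definition lie_metric (xi : V) (g : V -> V -> C) X Y : C :=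
  vapply xi (g X Y) - g (bracket xi X) Y - g X (bracket xi Y).

Definition killing (g : V -> V -> C) (xi : V) : Prop :=
  forall X Y, lie_metric xi g X Y = 0.

(* Tensor fields are C^oo(M)-multilinear maps on vector fields; [scalar] is
   C^oo(M)-linearity with values in C^oo(M). *)
Definition riemannian_metric (g : V -> V -> C) : Prop :=
  [/\ forall X, scalar (g X),
      forall X Y, g X Y = g Y X
    & forall X (p : M), tangent_at X p <> 0 -> 0 < g X X p].

Definition almost_contact_metric (phi : {linear V -> V}) (xi : V)
    (eta : {scalar V}) (g : V -> V -> C) : Prop :=
  [/\ forall X, phi (phi X) = - X + eta X *: xi,
      eta xi = 1
    & forall X Y, g (phi X) (phi Y) = g X Y - eta X * eta Y].

Definition fundamental_form (phi : V -> V) (g : V -> V -> C) X Y : C :=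
  g X (phi Y).

Definition nijenhuis (phi : V -> V) (xi : V) (eta : V -> C) X Y : V :=
  bracket (phi X) (phi Y) + phi (phi (bracket X Y))
  - phi (bracket (phi X) Y) - phi (bracket X (phi Y)) + ext_d1 eta X Y *: xi.

End TensorCalculus.

(* The indices 1, 2, 3 are represented by 0, 1, 2 : 'I_3. *)
Definition even_triple (i j k : 'I_3) : Prop :=
  exists2 s : 'S_3, ~~ odd_perm s & [/\ i = s 0, j = s 1 & k = s 2].

Lemma even_triple_cyc (i : 'I_3) : even_triple i (i + 1) (i + 2).
Proof.
pose r : 'S_3 := perm (addIr (1 : 'I_3)).
have r3 : (r * r * r = 1)%g.
  apply/permP => x; rewrite !permM perm1 !permE; apply/val_inj.
  by case: x => [[|[|[|]]]].
have r0 : odd_perm r = false.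
  by have := congr1 (@odd_perm _) r3; rewrite !odd_permM odd_perm1; case: odd_perm.
pose s (n : nat) : 'S_3 := iter n (fun t => r * t)%g 1%g.
have s0 n : odd_perm (s n) = false.
  by elim: n => [|n IH]; rewrite /s /= ?odd_perm1 // odd_permM r0 IH.
exists (s i); first by rewrite s0.
by case: i => [[|[|[|]]]] // ?; rewrite /s /=;
  split; rewrite ?permM perm1 ?permE; apply/val_inj.
Qed.

Record almost_3_contact (R : realType) (n : nat) (M : manifold R (4 * n + 3)) :=
    Almost3Contact {
  phi : 'I_3 -> {linear vfield M -> vfield M};
  xi : 'I_3 -> vfield M;
  eta : 'I_3 -> {scalar vfield M};
  metric : vfield M -> vfield M -> Cinfty M;
  metric_riemannian : riemannian_metric metric;
  contact_metric : forall i, almost_contact_metric (phi i) (xi i) (eta i) metric;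
  phi_compat : forall i j k, even_triple i j k -> forall X,
    phi k X = phi i (phi j X) - eta j X *: xi i /\
    phi k X = - phi j (phi i X) + eta i X *: xi j;
  xi_compat : forall i j k, even_triple i j k ->
    xi k = phi i (xi j) /\ xi k = - phi j (xi i);
  eta_compat : forall i j k, even_triple i j k -> forall X,
    eta k X = eta i (phi j X) /\ eta k X = - eta j (phi i X)
}.

Section Almost3Contact.
Variables (R : realType) (n : nat) (M : manifold R (4 * n + 3)).
Variable S : almost_3_contact M.
Local Notation C := (Cinfty M).
Local Notation V := (vfield M).
Local Notation g := (metric S).
Implicit Types (X Y Z : V) (i j k : 'I_3).

(* X is a section of H, the intersection of the kernels of the eta_i. *)
Definition horizontal X : Prop := forall i, eta S i X = 0.

Definition Phi i : V -> V -> C := fundamental_form (phi S i) g.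

Definition Nphi i X Y Z : C := g (nijenhuis (phi S i) (xi S i) (eta S i) X Y) Z.

Definition Aform i j X Y : C :=
  g (lie_endo (xi S j) (phi S i) X) Y
  + ext_d1 (eta S j) X (phi S i Y) + ext_d1 (eta S j) (phi S i X) Y.

Definition reeb_killing_function (beta : C) : Prop :=
  forall X Y, horizontal X -> horizontal Y ->
    (forall i, Aform i i X Y = 0) /\
    (forall i j k, even_triple i j k ->
       Aform i j X Y = beta * Phi k X Y /\ - Aform j i X Y = beta * Phi k X Y).

Definition skew_on_horizontal (T : V -> V -> V -> C) : Prop :=
  forall X Y Z, horizontal X -> horizontal Y -> horizontal Z ->
    T X Y Z = - T Y X Z /\ T X Y Z = - T X Z Y.

Definition canonical_with (beta : C) : Prop :=
  [/\ forall i, skew_on_horizontal (Nphi i),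
      forall i, killing g (xi S i),
      forall X Y Z, horizontal X -> horizontal Y -> horizontal Z ->
        forall i j,
          Nphi i X Y Z - ext_d2 (Phi i) (phi S i X) (phi S i Y) (phi S i Z) =
          Nphi j X Y Z - ext_d2 (Phi j) (phi S j X) (phi S j Y) (phi S j Z)
    & reeb_killing_function beta].

Definition canonical : Prop := exists beta, canonical_with beta.

Definition parallel_canonical : Prop := canonical_with 0.

Definition three_delta_cosymplectic (delta : R) : Prop :=
  forall i j k, even_triple i j k ->
    (forall X Y, ext_d1 (eta S i) X Y =
       (- 2 * delta) *: wedge (eta S j) (eta S k) X Y) /\
    (forall X Y Z, ext_d2 (Phi i) X Y Z = 0).

Lemma parallel_canonicalE :
  parallel_canonical <->
  canonical /\ (forall i j X Y,
    horizontal X -> horizontal Y -> Aform i j X Y = 0).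
Proof.
split=> [[C1 C2 C3 C4]|[[b [C1 C2 C3 C4]] A0]].
- split=> [|i j X Y hX hY]; first by exists 0.
  have [D E] := C4 X Y hX hY.
  have /or3P[/eqP->|/eqP->|/eqP->] : [|| j == i, j == i + 1 | i == j + 1].
  + by case: i j {D E} => [[|[|[|]]]] // ? [[|[|[|]]]].
  + exact: D.
  + by have [-> _] := E _ _ _ (even_triple_cyc i); rewrite mul0r.
  + have [_ /eqP] := E _ _ _ (even_triple_cyc j).
    by rewrite mul0r oppr_eq0 => /eqP.
- split=> // X Y hX hY; split=> [i|i j k _]; first exact: A0.
  by rewrite !A0 // mul0r oppr0.
Qed.

End Almost3Contact.

(* Main.v *)
(* On horizontal fields every d eta_i vanishes, so H is involutive, and
   d Phi_i (xi_a, X, Y) = 0 reduces to L_{xi_a} Phi_i = 0 on H.  Since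
   Phi_k (phi_i X, Y) = Phi_j (X, Y) on H, each xi_a preserves phi_i on H, hence
   also the horizontal metric; the vertical part of the Killing equation comes
   from the skewness of d eta_i (xi_j, xi_k) in all indices.  On the leaves of H
   the Phi_i are three closed forms related by the quaternionic structure, and
   Hitchin's lemma gives the vanishing of the Nijenhuis tensors. *)
Require Import Defs.
From mathcomp Require Import all_boot all_order all_algebra all_fingroup.
From mathcomp Require Import all_classical all_reals all_analysis.
From mathcomp Require Import ring.

Set Implicit Arguments.
Unset Strict Implicit.

(** * Vector fields as derivations of smooth functions *)

Section VectorFields.
Local Open Scope ring_scope.
Import GRing.Theory.
Variables (R : realType) (m : nat) (M : manifold R m).
Local Notation C := (Cinfty M).
Local Notation V := (vfield M).
Implicit Types (X Y Z : V) (f h : C).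

Lemma vapplyD X f h : vapply X (f + h) = vapply X f + vapply X h.
Proof.
have /asboolP[XD _] := vfield_derivation X.
by have := XD 1 f h; rewrite !scale1r.
Qed.

Lemma vapply0 X : vapply X 0 = 0.
Proof. by apply: (addrI (vapply X 0)); rewrite -vapplyD !addr0. Qed.

Lemma vapplyN X f : vapply X (- f) = - vapply X f.
Proof. by apply/eqP; rewrite -addr_eq0 -vapplyD addNr vapply0. Qed.

Lemma vapplyM X f h : vapply X (f * h) = f * vapply X h + h * vapply X f.
Proof. by have /asboolP[_] := vfield_derivation X; apply. Qed.

Lemma vapply1 X : vapply X 1 = 0.
Proof.
have := vapplyM X 1 1; rewrite !mul1r => X11.
by apply: (addrI (vapply X 1)); rewrite addr0.
Qed.

Lemma vapplyDl X Y f : vapply (X + Y) f = vapply X f + vapply Y f.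
Proof. by []. Qed.

Lemma vapplyZl h X f : vapply (h *: X) f = h * vapply X f.
Proof. by []. Qed.

Lemma vfieldP X Y : (forall f, vapply X f = vapply Y f) -> X = Y.
Proof. by move=> XY; apply/val_inj/funext. Qed.

Lemma bracketE X Y f :
  vapply (bracket X Y) f = vapply X (vapply Y f) - vapply Y (vapply X f).
Proof. by []. Qed.

Lemma bracketDr X Y Z : bracket X (Y + Z) = bracket X Y + bracket X Z.
Proof.
apply: vfieldP => f; rewrite vapplyDl !bracketE !vapplyDl vapplyD.
by rewrite opprD addrACA.
Qed.

Lemma bracketZr X h Y : bracket X (h *: Y) = vapply X h *: Y + h *: bracket X Y.
Proof.
apply: vfieldP => f; rewrite vapplyDl !vapplyZl !bracketE !vapplyZl vapplyM.
ring.
Qed.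

(** The ring of smooth functions has zero divisors but is reduced, since squares are taken pointwise
    in [R]. *)
Lemma Cinfty_sqr_eq0 f : f * f = 0 -> f = 0.
Proof.
move=> ff0; apply/val_inj/funext => p.
have /eqP : (f * f : C) p = 0 by rewrite ff0.
by rewrite mulf_eq0 orbb => /eqP.
Qed.

End VectorFields.

(** * Bilinearity of the metric and of its Lie derivative *)

Section Metric.
Local Open Scope ring_scope.
Import GRing.Theory.
Variables (R : realType) (m : nat) (M : manifold R m).
Local Notation C := (Cinfty M).
Local Notation V := (vfield M).
Variable g : V -> V -> C.
Hypothesis g_riem : riemannian_metric g.
Implicit Types (X Y Z : V) (f h : C).

Lemma metricC X Y : g X Y = g Y X.
Proof. by case: g_riem => _ gC _; exact: gC. Qed.

Lemma metricDr X Y Z : g X (Y + Z) = g X Y + g X Z.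
Proof.
by case: g_riem => gL _ _; have := gL X 1 Y Z; rewrite scale1r mul1r.
Qed.

Lemma metric0r X : g X 0 = 0.
Proof. by apply: (addrI (g X 0)); rewrite -metricDr !addr0. Qed.

Lemma metricZr X f Y : g X (f *: Y) = f * g X Y.
Proof.
by case: g_riem => gL _ _; have := gL X f Y 0; rewrite metric0r !addr0.
Qed.

Lemma metricNr X Y : g X (- Y) = - g X Y.
Proof. by rewrite -scaleN1r metricZr mulN1r. Qed.

Lemma metricDl X Y Z : g (Y + Z) X = g Y X + g Z X.
Proof. by rewrite metricC metricDr !(metricC X). Qed.

Lemma metricZl X f Y : g (f *: Y) X = f * g Y X.
Proof. by rewrite metricC metricZr (metricC X). Qed.

Lemma metricNl X Y : g (- Y) X = - g Y X.
Proof. by rewrite metricC metricNr (metricC X). Qed.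

Lemma lie_metricC (xi : V) X Y : lie_metric xi g X Y = lie_metric xi g Y X.
Proof.
by rewrite /lie_metric metricC (metricC _ Y) (metricC X) addrAC.
Qed.

Lemma lie_metricDl (xi : V) X Y Z :
  lie_metric xi g (X + Y) Z = lie_metric xi g X Z + lie_metric xi g Y Z.
Proof. by rewrite /lie_metric bracketDr !metricDl vapplyD; ring. Qed.

(** The two derivatives of [f] along [xi] cancel, so the Lie derivative of [g] is a tensor and can
    be tested on a frame-like splitting. *)
Lemma lie_metricZl (xi : V) f X Z :
  lie_metric xi g (f *: X) Z = f * lie_metric xi g X Z.
Proof.
by rewrite /lie_metric bracketZr metricDl !metricZl vapplyM; ring.
Qed.

End Metric.

(** * Hitchin's lemma for two closed forms *)

Section Nijenhuis.
Local Open Scope ring_scope.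
Import GRing.Theory.
Variables (R : realType) (m : nat) (M : manifold R m).
Local Notation C := (Cinfty M).
Local Notation V := (vfield M).

(** To be applied with [H] the horizontal fields, [A] = phi_i, [om2] = Phi_j and [om3] = - Phi_k;
    relativizing to [H] replaces passing to the leaves. *)
Variables (H : V -> Prop) (om2 om3 : V -> V -> C) (A : V -> V).
Hypothesis H_bracket : forall X Y, H X -> H Y -> H (bracket X Y).
Hypothesis HA : forall X, H X -> H (A X).
Hypothesis om2Dl : forall X Y Z, om2 (X + Y) Z = om2 X Z + om2 Y Z.
Hypothesis om2Nl : forall X Y, om2 (- X) Y = - om2 X Y.
Hypothesis AA : forall X, H X -> A (A X) = - X.
Hypothesis om3A : forall X Y, H X -> H Y -> om3 X Y = om2 (A X) Y.
Hypothesis om2A : forall X Y, H X -> H Y -> om2 (A X) Y = om2 X (A Y).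
Hypothesis d_om2 : forall X Y Z, H X -> H Y -> H Z -> ext_d2 om2 X Y Z = 0.
Hypothesis d_om3 : forall X Y Z, H X -> H Y -> H Z -> ext_d2 om3 X Y Z = 0.

(* The left-hand side equals d om3 (A X, Y, Z) + d om3 (X, A Y, Z)
   - d om2 (A X, A Y, Z) + d om2 (X, Y, Z), as om2 (A X) (A Y) = - om2 X Y. *)
Lemma torsion_eq0 X Y Z : H X -> H Y -> H Z ->
  om2 (bracket (A X) (A Y) - bracket X Y - A (bracket (A X) Y)
       - A (bracket X (A Y))) Z = 0.
Proof.
move=> hX hY hZ; have hAX := HA hX; have hAY := HA hY.
have om2AA U W : H U -> H W -> om2 (A U) (A W) = - om2 U W.
  by move=> hU hW; rewrite -om2A ?AA //; exact: HA.
transitivity (ext_d2 om3 (A X) Y Z + ext_d2 om3 X (A Y) Z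
              - ext_d2 om2 (A X) (A Y) Z + ext_d2 om2 X Y Z); last first.
  by rewrite !d_om2 // !d_om3 //; ring.
have hb U W : H U -> H W -> H (bracket U W) by exact: H_bracket.
rewrite /ext_d2 !om3A ?AA //; do ?[exact: hb | exact: HA].
(* Where [A] hits the bracket of [A X] or [A Y] with [Z], it moves to the other slot to match a term
   of d om2; in front of the bracket of [A X] with [Y] or of [X] with [A Y] it must stay. *)
rewrite !om2AA ?(@om2A (bracket (A X) Z)) ?(@om2A (bracket X Z))
  ?(@om2A (bracket (A Y) Z)) //;
  do ?[exact: hb | exact: HA].
rewrite !(om2Dl, om2Nl, vapplyN).
ring.
Qed.
End Nijenhuis.

(** * A single almost contact metric structure *)

Section AlmostContactMetric.
Local Open Scope ring_scope.
Import GRing.Theory.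
Variables (R : realType) (m : nat) (M : manifold R m).
Local Notation C := (Cinfty M).
Local Notation V := (vfield M).
Variables (g : V -> V -> C) (phi : {linear V -> V}) (xi : V) (eta : {scalar V}).
Hypothesis g_riem : riemannian_metric g.
Hypothesis acm : almost_contact_metric phi xi eta g.
Implicit Types X Y : V.

Let phiK X : phi (phi X) = - X + eta X *: xi. Proof. by case: acm. Qed.
Let eta_xi1 : eta xi = 1. Proof. by case: acm. Qed.

(** As phi^3 xi = 0, the formula for phi^2 gives phi xi = a xi with a = eta (phi xi); then eta (phi
    (phi xi)) = a^2 is zero, hence so is a. *)
Lemma phi_xi : phi xi = 0.
Proof.
have phi2 : phi (phi xi) = 0 by rewrite phiK eta_xi1 scale1r addNr.
have := phiK (phi xi); rewrite phi2 linear0 => /esym/eqP.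
rewrite addrC subr_eq0 => /eqP phi_xiE.
suff a0 : eta (phi xi) = 0 by rewrite -phi_xiE a0 scale0r.
apply: Cinfty_sqr_eq0; have /(congr1 eta) := phi2.
by rewrite -{1}phi_xiE linearZ /= linearZ /= linear0.
Qed.

(** Compare phi^2 (phi X) with phi (phi^2 X), using phi xi = 0. *)
Lemma eta_phi X : eta (phi X) = 0.
Proof.
have := congr1 phi (phiK X).
rewrite phiK linearD linearN linearZ /= phi_xi scaler0.
by move/addrI/(congr1 eta); rewrite linearZ linear0 /= eta_xi1 mulr1.
Qed.

Lemma metric_xi X : g xi X = eta X.
Proof.
have [_ _ /(_ xi X)] := acm.
rewrite phi_xi metricC // metric0r // eta_xi1 mul1r => /esym/eqP.
by rewrite subr_eq0 => /eqP.
Qed.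

Lemma metric_phi X Y : g (phi X) Y = - g X (phi Y).
Proof.
have [_ _ /(_ (phi X) Y)] := acm.
rewrite eta_phi mul0r subr0 => <-.
rewrite phiK metricDl // metricNl // metricZl // metric_xi eta_phi.
by rewrite mulr0 addr0.
Qed.

End AlmostContactMetric.

(** * Even permutations of the three indices *)

Section EvenTriples.
Local Open Scope ring_scope.
Import GRing.Theory.
Implicit Types i j k : 'I_3.

Lemma even_triple_rot i j k : even_triple i j k -> even_triple j k i.
Proof.
move=> [s s_even [-> -> ->]].
(* [r] sends 0, 1, 2 to 1, 2, 0. *)
have [r r_even [r0 r1 r2]] := even_triple_cyc 1.
exists (r * s)%g; first by rewrite odd_permM (negbTE r_even) (negbTE s_even).
rewrite !permM -r0 -r1 -r2.
by split; congr (s _); apply/val_inj.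
Qed.

Lemma even_triple_neq i j k :
  even_triple i j k -> [/\ i != j, j != k & k != i].
Proof. by move=> [s _ [-> -> ->]]; rewrite !(inj_eq perm_inj). Qed.

(** The even triple starting at [i] lists all three indices, so it covers every pair with first
    entry [i]. *)
Lemma even_triple_ind (P : 'I_3 -> 'I_3 -> Prop) :
  (forall i j k, even_triple i j k -> [/\ P i i, P i j & P i k]) ->
  forall i j, P i j.
Proof.
move=> Pijk i j; have [Pii Pij Pik] := Pijk _ _ _ (even_triple_cyc i).
have /or3P[/eqP->|/eqP->|/eqP->] : [|| j == i, j == i + 1 | j == i + 2] => //.
by case: i j {Pii Pij Pik} => [[|[|[|]]]] // ? [[|[|[|]]]].
Qed.

End EvenTriples.

(** * The three structures and the horizontal distribution *)

Section Almost3Contact.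
Local Open Scope ring_scope.
Import GRing.Theory.
Variables (R : realType) (n : nat) (M : manifold R (4 * n + 3)).
Variable S : almost_3_contact M.
Local Notation C := (Cinfty M).
Local Notation V := (vfield M).
Local Notation g := (metric S).
Local Notation H := (horizontal S).
Implicit Types (X Y Z : V) (i j k : 'I_3).

Lemma etai_phii i X : eta S i (phi S i X) = 0.
Proof. exact: eta_phi (contact_metric S i) X. Qed.

Lemma etai_phij i j k X : even_triple i j k -> eta S i (phi S j X) = eta S k X.
Proof. by move=> e; have [->] := eta_compat S e X. Qed.

Lemma etaj_phii i j k X :
  even_triple i j k -> eta S j (phi S i X) = - eta S k X.
Proof. by move=> e; have [_ ->] := eta_compat S e X; rewrite opprK. Qed.

(** Off the diagonal, xi_j and xi_k lie in the image of phi_i, which eta_i kills. *)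
Lemma eta_xi i j : eta S i (xi S j) = (i == j)%:R.
Proof.
move: i j; apply: even_triple_ind => i j k e.
have [ij _ ki] := even_triple_neq e.
have [xkE _] := xi_compat S e.
have [_ xjE] := xi_compat S (even_triple_rot (even_triple_rot e)).
split.
- by rewrite eqxx; have [_ ->] := contact_metric S i.
- by rewrite (negbTE ij) xjE linearN etai_phii oppr0.
- by rewrite eq_sym (negbTE ki) xkE etai_phii.
Qed.

Lemma metric_xil i X : g (xi S i) X = eta S i X.
Proof. exact: metric_xi (metric_riemannian S) (contact_metric S i) X. Qed.

Lemma metric_xir i X : g X (xi S i) = eta S i X.
Proof. by rewrite (metricC (metric_riemannian S)) metric_xil. Qed.

Lemma metric_phil i X Y : g (phi S i X) Y = - g X (phi S i Y).
Proof.
exact: metric_phi (metric_riemannian S) (contact_metric S i) X Y.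
Qed.

Lemma horizontal_phi i X : H X -> H (phi S i X).
Proof.
move=> hX j; move: i j; apply: even_triple_ind => i j k e.
split; first exact: etai_phii.
  by rewrite (etaj_phii _ e) hX oppr0.
by rewrite (etai_phij _ (even_triple_rot (even_triple_rot e))).
Qed.

Lemma phiphi i X : H X -> phi S i (phi S i X) = - X.
Proof.
by move=> hX; have [-> _ _] := contact_metric S i; rewrite hX scale0r addr0.
Qed.

Lemma phiij i j k X :
  even_triple i j k -> H X -> phi S i (phi S j X) = phi S k X.
Proof.
by move=> e hX; have [->] := phi_compat S e X; rewrite hX scale0r subr0.
Qed.

Lemma phiji i j k X :
  even_triple i j k -> H X -> phi S j (phi S i X) = - phi S k X.
Proof.
by move=> e hX; have [_ ->] := phi_compat S e X; rewrite hX scale0r addr0 opprK.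
Qed.

Definition hproj X : V := X - \sum_(a < 3) eta S a X *: xi S a.

Lemma horizontal_hproj X : H (hproj X).
Proof.
move=> i; rewrite /hproj linearB linear_sum /= (bigD1 i) //= linearZ /= eta_xi.
rewrite eqxx mulr1 big1 ?addr0 ?subrr // => a ai.
by rewrite linearZ /= eta_xi eq_sym (negbTE ai) mulr0.
Qed.

(** Every field is its horizontal projection plus a combination of the xi_a, so a symmetric tensor
    is determined by three blocks. *)
Lemma tensor_split_eq0 (T : V -> V -> C) :
  (forall X Y, T X Y = T Y X) ->
  (forall X Y Z, T (X + Y) Z = T X Z + T Y Z) ->
  (forall f X Z, T (f *: X) Z = f * T X Z) ->
  (forall X Y, H X -> H Y -> T X Y = 0) ->
  (forall i X, H X -> T (xi S i) X = 0) ->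
  (forall i j, T (xi S i) (xi S j) = 0) ->
  forall X Y, T X Y = 0.
Proof.
move=> TC TD TZ THH TxH Txx.
have T0 Z : T 0 Z = 0 by rewrite -(scale0r 0) TZ mul0r.
have split1 X Z : H X \/ (exists i, X = xi S i) -> T X Z = 0.
  move=> hX; rewrite -(subrK (\sum_(a < 3) eta S a Z *: xi S a) Z) TC TD TC.
  rewrite -/(hproj Z) (big_morph (T^~ X) (fun U W => TD U W X) (T0 X)).
  rewrite big1 => [|a _].
    rewrite addr0; have hZ := horizontal_hproj Z.
    by case: hX => [hX|[i ->]]; [exact: THH|exact: TxH].
  rewrite TZ; case: hX => [hX|[i ->]]; last by rewrite Txx mulr0.
  by rewrite TxH // mulr0.
move=> X Y; rewrite -(subrK (\sum_(a < 3) eta S a X *: xi S a) X) TD.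
rewrite -/(hproj X) split1 ?add0r; last by left; exact: horizontal_hproj.
rewrite (big_morph (T^~ Y) (fun U W => TD U W Y) (T0 Y)) big1 // => a _.
by rewrite TZ split1 ?mulr0 //; right; exists a.
Qed.

(** * Consequences of the cosymplectic equations *)

Section Cosymplectic.
Variable delta : R.
Hypothesis cosympl : three_delta_cosymplectic S delta.

Let d_eta i X Y : ext_d1 (eta S i) X Y =
  (- 2 * delta) *: wedge (eta S (i + 1)) (eta S (i + 2)) X Y.
Proof. by have [] := cosympl (even_triple_cyc i). Qed.

Let d_Phi i X Y Z : ext_d2 (Phi S i) X Y Z = 0.
Proof. by have [_] := cosympl (even_triple_cyc i). Qed.

(** Each term of the wedge evaluates a form on [Y]; [X] stays arbitrary so that Reeb fields can be
    inserted. *)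
Lemma d_eta_horizontal i X Y : H Y -> ext_d1 (eta S i) X Y = 0.
Proof.
by move=> hY; rewrite d_eta /wedge !hY mulr0 mul0r subrr scaler0.
Qed.

Lemma horizontal_bracket X Y : H X -> H Y -> H (bracket X Y).
Proof.
move=> hX hY i; have := d_eta_horizontal i X hY.
by rewrite /ext_d1 hX hY !vapply0 subrr sub0r => /eqP; rewrite oppr_eq0 => /eqP.
Qed.

Lemma horizontal_bracket_xi i X : H X -> H (bracket (xi S i) X).
Proof.
move=> hX j; have := d_eta_horizontal j (xi S i) hX; rewrite /ext_d1 hX eta_xi.
have -> : vapply X (j == i)%:R = 0.
  by case: eqP => _; rewrite ?vapply1 ?vapply0.
by rewrite vapply0 subrr sub0r => /eqP; rewrite oppr_eq0 => /eqP.
Qed.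

Lemma PhiE i X Y : Phi S i X Y = g X (phi S i Y). Proof. by []. Qed.

Lemma Phi_xi_horizontal i a X :
  H X -> Phi S i X (xi S a) = 0 /\ Phi S i (xi S a) X = 0.
Proof.
move=> hX; rewrite !PhiE metric_xil (horizontal_phi _ hX); split=> //.
have := metric_phil i X (xi S a).
rewrite metric_xir (horizontal_phi _ hX) => /esym/eqP.
by rewrite oppr_eq0 => /eqP.
Qed.

Lemma lie_xi_Phi a i X Y : H X -> H Y ->
  vapply (xi S a) (Phi S i X Y) =
  Phi S i (bracket (xi S a) X) Y + Phi S i X (bracket (xi S a) Y).
Proof.
move=> hX hY; have := d_Phi i (xi S a) X Y; rewrite /ext_d2.
have [_ ->] := Phi_xi_horizontal i a hY.
have [_ ->] := Phi_xi_horizontal i a hX.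
have [-> _] := Phi_xi_horizontal i a (horizontal_bracket hX hY).
rewrite !vapply0 !subr0 addr0 => e; rewrite -[RHS]add0r -e.
rewrite (_ : Phi S i (bracket (xi S a) Y) X = - Phi S i X (bracket (xi S a) Y)).
  by ring.
by rewrite !PhiE (metricC (metric_riemannian S)) metric_phil.
Qed.

(** Differentiate Phi_k (phi_i X, Z) = Phi_j (X, Z) along xi_a: both forms are preserved, so the
    terms in [xi_a, Z] cancel. *)
Lemma lie_xi_phi a i X Y : H X -> H Y ->
  g (lie_endo (xi S a) (phi S i) X) Y = 0.
Proof.
have gR := metric_riemannian S.
pose j := i + 1; pose k := i + 2.
have e : even_triple i j k := even_triple_cyc i.
(* Testing against phi_k Z suffices, as phi_k is invertible on H, and it makes Phi_k appear. *)
suff phiY Z : H X -> H Z ->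
    g (lie_endo (xi S a) (phi S i) X) (phi S k Z) = 0.
  move=> hX hY; have := phiY _ hX (horizontal_phi k hY).
  by rewrite phiphi // metricNr // => /eqP; rewrite oppr_eq0 => /eqP.
move=> hX hZ; have hiX := horizontal_phi i hX.
have hxX := horizontal_bracket_xi a hX; have hxZ := horizontal_bracket_xi a hZ.
have PhikE U W : H U -> H W -> Phi S k (phi S i U) W = Phi S j U W.
  move=> hU hW; rewrite !PhiE metric_phil.
  by rewrite (phiji (even_triple_rot (even_triple_rot e))) // metricNr // opprK.
have := lie_xi_Phi a k hiX hZ; rewrite !PhikE // lie_xi_Phi //.
rewrite /lie_endo metricDl // metricNl // -!(PhiE k) PhikE //.
by move/addIr => ->; rewrite subrr.
Qed.

Lemma Aform_eq0 i j X Y : H X -> H Y -> Aform S i j X Y = 0.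
Proof.
move=> hX hY; rewrite /Aform lie_xi_phi //.
by rewrite !d_eta_horizontal ?addr0 //; exact: horizontal_phi.
Qed.

Lemma lie_metric_horizontal a X Y : H X -> H Y -> lie_metric (xi S a) g X Y = 0.
Proof.
have gR := metric_riemannian S; pose i : 'I_3 := 0.
move=> hX hY; have hiX := horizontal_phi i hX.
have hxX := horizontal_bracket_xi a hX.
(* This writes the metric through Phi_i and phi_i, both preserved by xi_a; the index 0 is an
   arbitrary choice. *)
have gE U W : H U -> g U W = Phi S i (phi S i U) W.
  move=> hU; rewrite PhiE; have [_ _ ->] := contact_metric S i.
  by rewrite hU mul0r subr0.
have /eqP := lie_xi_phi a i hX (horizontal_phi i hY).
rewrite /lie_endo metricDl // metricNl // subr_eq0 => /eqP lie_phi.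
rewrite /lie_metric (gE X) // lie_xi_Phi // [in X in X + _]PhiE lie_phi.
by rewrite -PhiE -!gE //; ring.
Qed.

(** In d Phi_a (xi_a, xi_b, Y) the index of Phi is chosen so that xi_a is in its kernel; only Phi_a
    ([xi_a, xi_b], Y) survives. *)
Lemma bracket_xi_orthogonal a b X : H X -> g (bracket (xi S a) (xi S b)) X = 0.
Proof.
have gR := metric_riemannian S.
have Phi_axi Y : Phi S a (xi S a) Y = 0 by rewrite PhiE metric_xil etai_phii.
suff br_phi Y : H Y -> g (bracket (xi S a) (xi S b)) (phi S a Y) = 0.
  move=> hX; have := br_phi _ (horizontal_phi a hX).
  by rewrite phiphi // metricNr // => /eqP; rewrite oppr_eq0 => /eqP.
move=> hY; have := d_Phi a (xi S a) (xi S b) Y; rewrite /ext_d2 !Phi_axi.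
have [_ ->] := Phi_xi_horizontal a b hY.
have [-> _] := Phi_xi_horizontal a b (horizontal_bracket_xi a hY).
have [-> _] := Phi_xi_horizontal a a (horizontal_bracket_xi b hY).
by rewrite !vapply0 !subr0 !addr0 sub0r => /eqP; rewrite oppr_eq0 => /eqP.
Qed.

Lemma vapply_eta_xi X i j : vapply X (eta S i (xi S j)) = 0.
Proof. by rewrite eta_xi; case: eqP => _; rewrite ?vapply1 ?vapply0. Qed.

(** The wedge is the Levi-Civita symbol of (i, a, b): for nonzero [delta] the Reeb fields bracket as
    in so(3). *)
Lemma eta_bracket_xi i a b : eta S i (bracket (xi S a) (xi S b)) =
  (2 * delta) *: wedge (eta S (i + 1)) (eta S (i + 2)) (xi S a) (xi S b).
Proof.
have := d_eta i (xi S a) (xi S b); rewrite /ext_d1 !vapply_eta_xi subrr sub0r.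
by move/(congr1 -%R); rewrite opprK => ->; rewrite mulNr scaleNr opprK.
Qed.

Lemma killing_xi a : killing g (xi S a).
Proof.
have gR := metric_riemannian S.
apply: tensor_split_eq0.
- exact: lie_metricC gR (xi S a).
- exact: lie_metricDl gR (xi S a).
- exact: lie_metricZl gR (xi S a).
- exact: lie_metric_horizontal.
- move=> i X hX; rewrite /lie_metric !metric_xil hX bracket_xi_orthogonal //.
  by rewrite (horizontal_bracket_xi a hX) vapply0 !subr0.
- move=> i j; rewrite /lie_metric metric_xir metric_xil metric_xir.
  rewrite vapply_eta_xi !eta_bracket_xi -addrA -opprD -scalerDr sub0r.
  (* The two symbols differ by exchanging [i] and [j], hence are opposite; all 27 index triples are
     checked. *)
  rewrite [X in _ *: X](_ : _ = 0) ?scaler0 ?oppr0 // /wedge !eta_xi.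
  case: a i j => [[|[|[|]]]] // ? [[|[|[|]]]] // ? [[|[|[|]]]] // ?;
    by rewrite -!val_eqE /=; ring.
Qed.

Lemma nijenhuis_horizontal i X Y Z :
  H X -> H Y -> H Z -> Nphi S i X Y Z = 0.
Proof.
have gR := metric_riemannian S.
pose j := i + 1; pose k := i + 2.
have e : even_triple i j k := even_triple_cyc i.
(* Pairing with phi_j W turns the metric into Phi_j, the form [om2] of [torsion_eq0]. *)
suff Nphi_phi W : H X -> H Y -> H W -> Nphi S i X Y (phi S j W) = 0.
  move=> hX hY hZ; have := Nphi_phi _ hX hY (horizontal_phi j hZ).
  by rewrite phiphi // /Nphi metricNr // => /eqP; rewrite oppr_eq0 => /eqP.
move=> hX hY hW.
rewrite /Nphi /nijenhuis d_eta_horizontal // scale0r addr0.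
rewrite (phiphi i (horizontal_bracket hX hY)).
(* The sign comes from moving phi_i across g: Phi_j (phi_i U, W) = - g (U, phi_i (phi_j W)). *)
pose om3 U W := - Phi S k U W.
apply: (@torsion_eq0 _ _ _ H (Phi S j) om3 (phi S i)) => //.
- exact: horizontal_bracket.
- exact: horizontal_phi.
- by move=> *; rewrite !PhiE metricDl.
- by move=> *; rewrite !PhiE metricNl.
- exact: phiphi.
- move=> U U' hU hU'; rewrite !PhiE metric_phil (phiij e) //.
- move=> U U' hU hU'; rewrite !PhiE metric_phil (phiij e) // (phiji e) //.
  by rewrite metricNr.
- move=> U U' U'' _ _ _; have := d_Phi k U U' U''; rewrite /ext_d2 /om3 !vapplyN.
  by move/(congr1 -%R); rewrite oppr0 => <-; ring.
Qed.

End Cosymplectic.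
End Almost3Contact.

Theorem corollary2p1p2 (R : realType) (n : nat) (M : manifold R (4 * n + 3))
    (S : almost_3_contact M) (delta : R) :
  three_delta_cosymplectic S delta -> parallel_canonical S.
Proof.
move=> cosympl; split.
- move=> i X Y Z hX hY hZ; rewrite !(nijenhuis_horizontal cosympl) //.
  by rewrite GRing.oppr0.
- exact: killing_xi cosympl.
(* All four terms of the equation vanish separately. *)
- move=> X Y Z hX hY hZ i j; rewrite !(nijenhuis_horizontal cosympl) //.
  have [_ ->] := cosympl _ _ _ (even_triple_cyc i).
  by have [_ ->] := cosympl _ _ _ (even_triple_cyc j).
- move=> X Y hX hY; split=> [i|i j k _]; rewrite !(Aform_eq0 cosympl) //.
  by rewrite GRing.mul0r GRing.oppr0.
Qed.
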